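(* The complex valued function $$\psi(x,y)=\cos y-\cos x+\mathrm{i}\sin y$$ satisfies the Helmholtz equation $\psi_{xx}+\psi_{yy}+\psi=0$ and has the hyperbolic singularity at the origin. Moreover, the function $$\Psi(x,y,t)=(\cos y-\cos x+\mathrm{i}\sin y)\cos t+\cos y\,\sin t$$ is a Helmholtz wave (for $k=1$, $c=1$) which realizes, at the origin and $t=0$, the hyperbolic singularity together with its generic bifurcation $\mathrm{H}_t$: $(x,y,t)\mapsto x^2-y^2+t+\mathrm{i}y$.
   Context: $\mathbb{C}$ is identified with $\mathbb{R}^2$ via $u+\mathrm{i}w=(u,w)$. A Helmholtz wave for $k,c>0$ is a smooth function $\Psi(x,y,t)$ satisfying both the Helmholtz equation $\Psi_{xx}+\Psi_{yy}+k^2\Psi=0$ and the wave equation $\Psi_{tt}=c^2(\Psi_{xx}+\Psi_{yy})$. A radial transformation near $0\in\mathbb{C}$ is a local diffeomorphism $\tau:(\mathbb{C},0)\to(\mathbb{C},0)$, $\tau(u,w)=(U,W)$, sending each radial line (ray) $\{\theta=\mathrm{const.}\}$ to a radial line, where $u+\mathrm{i}w=re^{\mathrm{i}\theta}$; equivalently $U=\rho(u,w)(au+bw)$, $W=\rho(u,w)(cu+dw)$ with $\rho$ a positive function and $a,b,c,d\in\mathbb{R}$, $ad-bc\neq0$. Two germs $\psi:(\mathbb{R}^2,p)\to(\mathbb{C},0)$ and $\varphi:(\mathbb{R}^2,q)\to(\mathbb{C},0)$ are radially equivalent if $\psi\circ\sigma=\tau\circ\varphi$ for some local diffeomorphism $\sigma:(\mathbb{R}^2,q)\to(\mathbb{R}^2,p)$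 and some local radial transformation $\tau$. A function has the hyperbolic singularity at a point if its germ there is radially equivalent to the germ at the origin of $x^2-y^2+\mathrm{i}y$. $\Psi$ realizes the bifurcation $F(x,y,t)$ at the origin and $t=0$ if the two family germs are radially equivalent as families: there are a local diffeomorphism $t\mapsto s(t)$ of $(\mathbb{R},0)$, a smooth family of local diffeomorphisms $\sigma_t$ of the plane (defined near the origin for $t$ near $0$, with $\sigma_0(0,0)=(0,0)$), and a smooth family of local radial transformations $\tau_t$ of $(\mathbb{C},0)$, such that $\Psi(\sigma_t(x,y),s(t))=\tau_t(F(x,y,t))$ for $(x,y,t)$ near the origin. *)

(* Defs.v *)
From mathcomp Require Import all_boot all_order all_algebra.
From mathcomp Require Import all_classical all_reals all_analysis.
Import numFieldNormedType.Exports.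

Set Implicit Arguments.
Unset Strict Implicit.
Unset Printing Implicit Defensive.

Import Order.TTheory GRing.Theory Num.Theory.

Local Open Scope classical_set_scope.
Local Open Scope ring_scope.

(* [R * R] serves both as the source plane and as the complex plane, u + i w
   being the pair (u, w); a point (x, y, t) of space-time has type
   [R * R * R], so that a family indexed by t is a function of (p, t). *)

Section Smooth.
Context {R : realType} {V W : normedModType R}.

(* Meaningful for [U] open and [V] finite-dimensional, where x |-> 'd f x is
   of class C^k iff x |-> 'D_v f x is so for every v. *)
Fixpoint class_C (k : nat) (U : set V) (f : V -> W) : Prop :=
  if k is k'.+1 then
    (forall x, U x -> differentiable f x) /\
    (forall v, class_C k' U (fun x => 'D_v f x))
  else forall x, U x -> {for x, continuous f}.

Definition smooth_on (U : set V) (f : V -> W) : Prop :=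
  forall k, class_C k U f.

End Smooth.

Section Diffeomorphisms.
Context {R : realType} {V W : normedModType R}.

Definition diffeo_on (U : set V) (f : V -> W) : Prop :=
  [/\ open U, open (f @` U), smooth_on U f &
      exists2 g : W -> V, smooth_on (f @` U) g &
        forall x, U x -> g (f x) = x].

(* f : (V, q) -> (W, p) *)
Definition local_diffeo (f : V -> W) (q : V) (p : W) : Prop :=
  f q = p /\ exists2 U : set V, open_nbhs q U & diffeo_on U f.

End Diffeomorphisms.

Section Radial.
Context {R : realType}.

Definition ray (theta : R) : set (R * R) :=
  [set z | exists2 r : R, 0 < r & z = (r * cos theta, r * sin theta)].

Definition radial_on (U : set (R * R)) (tau : R * R -> R * R) : Prop :=
  [/\ diffeo_on U tau, tau (0, 0) = (0, 0) &
      forall theta, exists theta', tau @` (U `&` ray theta) `<=` ray theta'].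

Definition local_radial (tau : R * R -> R * R) : Prop :=
  exists2 U : set (R * R), open_nbhs (0, 0) U & radial_on U tau.

(* psi : (R^2, p) -> (C, 0) and phi : (R^2, q) -> (C, 0) *)
Definition radially_equivalent (psi : R * R -> R * R) (p : R * R)
    (phi : R * R -> R * R) (q : R * R) : Prop :=
  [/\ psi p = (0, 0), phi q = (0, 0) &
      exists sigma tau : R * R -> R * R,
        [/\ local_diffeo sigma q p, local_radial tau &
            \forall z \near q, psi (sigma z) = tau (phi z)]].

Definition hyperbolic_germ (z : R * R) : R * R :=
  (z.1 ^+ 2 - z.2 ^+ 2, z.2).

Definition has_hyperbolic_singularity (psi : R * R -> R * R) (p : R * R) :=
  radially_equivalent psi p hyperbolic_germ (0, 0).

(* The neighbourhood [U] on which the members of a family are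
   diffeomorphisms, resp. radial transformations, does not depend on t. *)
Definition local_diffeo_family (sigma : R -> R * R -> R * R) : Prop :=
  exists (U : set (R * R)) (J : set R),
    [/\ open_nbhs (0, 0) U, open_nbhs 0 J,
        smooth_on (U `*` J) (fun q : R * R * R => sigma q.2 q.1) &
        forall t, J t -> diffeo_on U (sigma t)].

Definition local_radial_family (tau : R -> R * R -> R * R) : Prop :=
  exists (U : set (R * R)) (J : set R),
    [/\ open_nbhs (0, 0) U, open_nbhs 0 J,
        smooth_on (U `*` J) (fun q : R * R * R => tau q.2 q.1) &
        forall t, J t -> radial_on U (tau t)].

Definition realizes_bifurcation (Psi F : R * R * R -> R * R) : Prop :=
  [/\ Psi (0, 0, 0) = (0, 0), F (0, 0, 0) = (0, 0) &
      exists (s : R -> R) (sigma tau : R -> R * R -> R * R),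
        [/\ local_diffeo s 0 0,
            local_diffeo_family sigma /\ sigma 0 (0, 0) = (0, 0),
            local_radial_family tau &
            \forall q \near ((0, 0, 0) : R * R * R),
              Psi (sigma q.2 q.1, s q.2) = tau q.2 (F q)]].

Definition hyperbolic_bifurcation (q : R * R * R) : R * R :=
  let: (x, y, t) := q in (x ^+ 2 - y ^+ 2 + t, y).

End Radial.

Section Waves.
Context {R : realType}.

Definition helmholtz_solution (k : R) (psi : R * R -> R * R) : Prop :=
  smooth_on setT psi /\
  forall p, 'D_(1, 0) ('D_(1, 0) psi) p + 'D_(0, 1) ('D_(0, 1) psi) p
            + k ^+ 2 *: psi p = 0.

Definition helmholtz_wave (k c : R) (Psi : R * R * R -> R * R) : Prop :=
  [/\ 0 < k, 0 < c, smooth_on setT Psi,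
      forall q, 'D_(1, 0, 0) ('D_(1, 0, 0) Psi) q
                + 'D_(0, 1, 0) ('D_(0, 1, 0) Psi) q + k ^+ 2 *: Psi q = 0 &
      forall q, 'D_(0, 0, 1) ('D_(0, 0, 1) Psi) q =
                c ^+ 2 *: ('D_(1, 0, 0) ('D_(1, 0, 0) Psi) q
                           + 'D_(0, 1, 0) ('D_(0, 1, 0) Psi) q)].

End Waves.

(* Main.v *)
Require Import Defs.
From mathcomp Require Import all_boot all_order all_algebra.
From mathcomp Require Import ring lra.
From mathcomp Require Import all_classical all_reals all_analysis.
Import numFieldNormedType.Exports.

Set Implicit Arguments.
Unset Strict Implicit.
Unset Printing Implicit Defensive.

Import Order.TTheory GRing.Theory Num.Theory.

Local Open Scope classical_set_scope.
Local Open Scope ring_scope.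

(** The equation between Psi and H_t is solved in closed form, so that every
    diffeomorphism comes with an explicit smooth inverse and no inverse function
    theorem or division theorem is involved.

    Write s for the time of Psi and T = tan s.  Up to the positive factor cos s,
    which is harmless for radial maps, Psi is
      ((1 + T) cos Y - cos X, sin Y).
    It folds along X = 0, and the image of the fold is the ellipse
    ((1 + T) cos Y - 1, sin Y); H_t folds along x = 0, and the image is the
    parabola (t - y^2, y).  A radial map (u, w) |-> rho (a u, w) carrying the
    parabola to the ellipse must satisfy sin Y = rho y and
    (1 + T) cos Y - 1 = a rho (t - y^2) at corresponding points.  The half-angle
    substitution y = tan (Y/2) turns the ellipse into a rational curve, and these
    equations then hold for
      rho = 2 / (1 + y^2),   a = 1 / (1 - t),   T = 2 t / (1 - t).
    This gives the target map (u, w) |-> cos s * rho (w) * (u / (1 - t), w), the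
    time change s = atan (2 t / (1 - t)), and Y = 2 atan y.

    With these choices the remaining equation becomes
      1 - cos X = 2 x^2 / ((1 - t) (1 + y^2)),
    whose left-hand side is 2 sin^2 (X/2): both sides are squares, and
      sin (X/2) = x cos (atan y) / sqrt (1 - t)
    defines a smooth X ([wave_conjugacy]).  The maps are inverted by half-angle
    formulas ([diffeo_wave_time], [diffeo_wave_source], [diffeo_wave_target]),
    and the target map is radial because its two components are a common
    positive multiple of (u / (1 - t), w) ([radial_wave_target]).  The member
    t = 0 of the family gives the singularity of psi.

    Smoothness is obtained from closure properties of the classes C^k (sums,
    products, pairs, composition with a smooth function of one variable),
    proved by induction on k, and from the derivatives of sin, cos, atan, asin,
    sqrt and the inverse. *)

(** * Functions of class C^k *)

Section ClassC.
Context {R : realType}.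

(** The remainder of the first-order expansion at [x] only sees values near [x]. *)
Lemma is_diff_near_eq (V W : normedModType R) (f g : V -> W) (x : V) :
  (\forall y \near x, f y = g y) -> differentiable f x -> is_diff x g ('d f x).
Proof.
move=> fg dfx.
have gE : g \o shift x = cst (g x) + 'd f x +o_ 0 id.
  apply/eqaddoP => e e0.
  have /eqaddoP/(_ e e0) := diff_locally dfx.
  have fg0 : \forall h \near 0, f (h + x) = g (h + x).
    by move: fg; rewrite (near_shift 0) /=; apply: filterS => h; rewrite subr0.
  apply: filter_app; near=> h.
  have /= fgh : f (h + x) = g (h + x) by near: h; exact: fg0.
  rewrite !fctE /cst/= fgh.
  by rewrite (nbhs_singleton fg).
have dE := diff_unique (diff_continuous dfx) gE.
apply: DiffDef => //; apply/diff_locallyP; rewrite dE; split => //.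
exact: diff_continuous.
Unshelve. all: by end_near. Qed.

Variable V : normedModType R.
Implicit Types W : normedModType R.

(** The derivatives at points outside [U] may differ, so this is not a mere
    rewriting of functions; openness of [U] makes equality on [U] local. *)
Lemma class_C_eq W k (U : set V) (f g : V -> W) : open U ->
  (forall x, U x -> f x = g x) -> class_C k U f -> class_C k U g.
Proof.
move=> oU; elim: k f g => [|k IH] f g fg.
  move=> cf x Ux; have fgx : \forall y \near x, f y = g y.
    by near=> y; apply: fg; near: y; exact: open_nbhs_nbhs.
  rewrite /prop_for /continuous_at -(fg _ Ux).
  by apply: cvg_trans (cf _ Ux); exact: near_eq_cvg.
move=> [df cf]; have dg x : U x -> is_diff x g ('d f x).
  move=> Ux; apply: is_diff_near_eq (df _ Ux).
  by near=> y; apply: fg; near: y; exact: open_nbhs_nbhs.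
split=> [x /dg//|v]; apply: IH (cf v) => x Ux.
have dgx := dg _ Ux.
by rewrite !deriveE ?diff_val//; exact: df.
Unshelve. all: by end_near. Qed.

Lemma class_CW W k (U : set V) (f : V -> W) : class_C k.+1 U f -> class_C k U f.
Proof.
elim: k f => [|k IH] f [df cf]; first by move=> x /df/differentiable_continuous.
by split=> // v; apply: IH; exact: cf.
Qed.

(** Packages the inductive step of every closure property: a formula for the
    differential on [U], together with one degree of regularity less for each
    directional derivative. *)
Lemma class_CS W k (U : set V) (f : V -> W) (df : V -> V -> W) : open U ->
  (forall x, U x -> is_diff x f (df x)) ->
  (forall v, class_C k U (fun x => df x v)) -> class_C k.+1 U f.
Proof.
move=> oU dfx cdf; split=> [x /dfx[]//|v].
apply: class_C_eq (cdf v) => // x Ux; have [d <-] := dfx _ Ux.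
by rewrite deriveE.
Qed.

Lemma class_C_cst W k (U : set V) (c : W) : class_C k U (fun=> c).
Proof.
elim: k c => [|k IH] c; first by move=> x _; exact: cst_continuous.
split=> [x _|v]; first exact: differentiable_cst.
have -> : (fun x => 'D_v (fun=> c : W) x) = fun=> 0.
  by apply/funext => x; rewrite derive_cst.
exact: IH.
Qed.

Lemma class_CD W k (U : set V) (f g : V -> W) : open U ->
  class_C k U f -> class_C k U g -> class_C k U (fun x => f x + g x).
Proof.
move=> oU; elim: k f g => [|k IH] f g.
  by move=> cf cg x Ux; apply: cvgD; [exact: cf|exact: cg].
move=> [df cf] [dg cg].
apply: (class_CS (df := fun x v => 'D_v f x + 'D_v g x)) => // [x Ux|v].
  have dfx := differentiableP (df _ Ux); have dgx := differentiableP (dg _ Ux).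
  apply: is_diff_eq (is_diffD dfx dgx) _; apply/funext => v /=.
  by rewrite !deriveE; [| exact: dg | exact: df].
exact: IH (cf v) (cg v).
Qed.

Lemma class_CM k (U : set V) (f g : V -> R) : open U ->
  class_C k U f -> class_C k U g -> class_C k U (fun x => f x * g x).
Proof.
move=> oU; elim: k f g => [|k IH] f g.
  by move=> cf cg x Ux; apply: cvgM; [exact: cf|exact: cg].
move=> cf1 cg1; have [df cf] := cf1; have [dg cg] := cg1.
apply: (class_CS (df := fun x v => f x * 'D_v g x + g x * 'D_v f x))
  => // [x Ux|v].
  have dfx := differentiableP (df _ Ux); have dgx := differentiableP (dg _ Ux).
  apply: is_diff_eq (is_diffM dfx dgx) _; apply/funext => v /=.
  by rewrite !deriveE; [| exact: df | exact: dg].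
apply: class_CD => //; apply: IH => //; try exact: class_CW; [exact: cg|exact: cf].
Qed.

Lemma class_CN k (U : set V) (f : V -> R) : open U ->
  class_C k U f -> class_C k U (fun x => - f x).
Proof.
move=> oU cf; have -> : (fun x => - f x) = fun x => -1 * f x.
  by apply/funext => x; rewrite mulN1r.
by apply: class_CM => //; exact: class_C_cst.
Qed.

Lemma class_C_pair W1 W2 k (U : set V) (f : V -> W1) (g : V -> W2) : open U ->
  class_C k U f -> class_C k U g -> class_C k U (fun x => (f x, g x)).
Proof.
move=> oU; elim: k f g => [|k IH] f g.
  by move=> cf cg x Ux; apply: cvg_pair; [exact: cf|exact: cg].
move=> [df cf] [dg cg].
apply: (class_CS (df := fun x v => ('D_v f x, 'D_v g x))) => // [x Ux|v].
  have dfx := differentiableP (df _ Ux); have dgx := differentiableP (dg _ Ux).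
  apply: is_diff_eq (is_diff_pair dfx dgx) _; apply/funext => v /=.
  by rewrite !deriveE; [| exact: dg | exact: df].
exact: IH (cf v) (cg v).
Qed.

Lemma class_C_linear W1 W2 (l : {linear W1 -> W2}) k (U : set V) (f : V -> W1) :
  open U -> continuous l -> class_C k U f -> class_C k U (fun x => l (f x)).
Proof.
move=> oU cl; elim: k f => [|k IH] f.
  by move=> cf x Ux; apply: continuous_comp; [exact: cf|exact: cl].
move=> [df cf].
apply: (class_CS (df := fun x v => l ('D_v f x))) => // [x Ux|v].
  have dfx := df _ Ux; apply: DiffDef.
    by apply: differentiable_comp => //; exact: linear_differentiable.
  rewrite diff_comp ?diff_lin//; last exact: linear_differentiable.
  by apply/funext => v /=; rewrite deriveE.
exact: IH (cf v).
Qed.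

Lemma class_C_id k (U : set V) : open U -> class_C k U (fun x => x).
Proof.
move=> oU; case: k => [|k]; first by move=> x _; exact: cvg_id.
by apply: (class_CS (df := fun _ v => v)) => // v; exact: class_C_cst.
Qed.

(** By the chain rule each directional derivative is a product with [h'] composed
    with [f], so the induction runs over all smooth [h] at once.  One-variable
    outer functions suffice to build every map below, the other operations being
    sums, products and pairs. *)
Lemma class_C_comp k (U : set V) (B : set R) (h : R -> R) (f : V -> R) :
  open U -> smooth_on B h -> (forall x, U x -> B (f x)) ->
  class_C k U f -> class_C k U (fun x => h (f x)).
Proof.
move=> oU + fB; elim: k h => [|k IH] h ch.
  move=> cf x Ux; apply: continuous_comp; first exact: cf.
  by apply: (ch 0%N); exact: fB.
move=> cf1; have [df cf] := cf1.
have [dhB _] := ch 1%N; have dh x (Ux : U x) := dhB _ (fB _ Ux).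
apply: (class_CS (df := fun x v => 'D_v f x * 'D_1 h (f x)))
  => // [x Ux|v].
  have dfx := differentiableP (df _ Ux); have dhx := differentiableP (dh _ Ux).
  apply: is_diff_eq (is_diff_comp dfx dhx) _; apply/funext => v /=.
  rewrite !deriveE; [|exact: dh|exact: df].
  by rewrite -[X in 'd h _ X]mulr1 linearZ.
apply: class_CM => //; first exact: cf.
apply: (IH ('D_1 h)); last exact: class_CW.
by move=> n; have [_] := ch n.+1; apply.
Qed.

End ClassC.

(** * Smoothness of the elementary functions *)

Section Elementary.
Context {R : realType}.

Lemma class_C_derive1 k (B : set R) (h h' : R -> R) : open B ->
  (forall x, B x -> is_derive x 1 h (h' x)) -> class_C k B h' ->
  class_C k.+1 B h.
Proof.
move=> oB dh ch'; apply: (class_CS (df := fun x v : R => v * h' x) oB) => [x Bx|v].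
  have [/derivable1_diffP dhx <-] := dh _ Bx.
  by apply: DiffDef => //; rewrite diff1E// derive1E.
by apply: class_CM => //; exact: class_C_cst.
Qed.

(** Simultaneous, since each of the two functions is the derivative of the other
    up to sign. *)
Lemma class_C_trigo k : class_C k [set: R] sin /\ class_C k [set: R] cos.
Proof.
elim: k => [|k [csin ccos]].
  by split=> x _; [exact: continuous_sin|exact: continuous_cos].
split; first by apply: class_C_derive1 ccos; exact: openT.
apply: (class_C_derive1 (h' := fun x => - sin x)) => //; first exact: openT.
by apply: class_CN => //; exact: openT.
Qed.

Lemma open_neq0 : open [set x : R | x != 0].
Proof.
rewrite (_ : [set x | _] = ~` [set 0]).
  by rewrite openC; exact: closed_eq.
by apply/seteqP; split=> x /= /eqP.
Qed.

(** The derivative is again a polynomial in the inverse, so that the induction on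
    the order of differentiability closes up; the same happens for [smooth_sqrt]. *)
Lemma smooth_inv : smooth_on [set x : R | x != 0] GRing.inv.
Proof.
elim=> [|k IH]; first by move=> x /inv_continuous.
apply: (class_C_derive1 (h' := fun x => - (x^-1 * x^-1))); first exact: open_neq0.
  move=> x /= x0; have := is_deriveV x0 (is_derive_id x 1).
  by rewrite !scaler1 -exprVn expr2.
by apply: class_CN; [exact: open_neq0|apply: class_CM => //; exact: open_neq0].
Qed.

Lemma smooth_sqrt : smooth_on [set x : R | 0 < x] Num.sqrt.
Proof.
elim=> [|k IH]; first by move=> x _; exact: sqrt_continuous.
have o0 : open [set x : R | 0 < x] by exact: open_gt.
apply: (class_C_derive1 (h' := fun x => (2 * Num.sqrt x)^-1)) => //.
apply: (class_C_comp (h := GRing.inv) o0 smooth_inv) => [x/= x0|].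
  by rewrite mulf_neq0// gt_eqF// sqrtr_gt0.
by apply: class_CM => //; exact: class_C_cst.
Qed.

Lemma smooth_atan : smooth_on [set: R] atan.
Proof.
case=> [|k]; first by move=> x _; exact: continuous_atan.
apply: (class_C_derive1 (h' := fun x => (1 + x * x)^-1)); first exact: openT.
apply: (class_C_comp (h := GRing.inv) openT smooth_inv) => [x _ /=|].
  by rewrite gt_eqF// ltr_pwDl// -expr2 sqr_ge0.
apply: class_CD; [exact: openT|exact: class_C_cst|].
by apply: class_CM; [exact: openT|apply: class_C_id; exact: openT..].
Qed.

Lemma smooth_asin : smooth_on [set x : R | -1 < x < 1] asin.
Proof.
case=> [|k]; first by move=> x; exact: continuous_asin.
have oI : open [set x : R | -1 < x < 1].
  by rewrite -set_itvoo; exact: interval_open.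
apply: (class_C_derive1 (h' := fun x => (Num.sqrt (1 - x * x))^-1)) => //.
have pos (x : R) : -1 < x < 1 -> 0 < 1 - x * x by move=> ?; nra.
apply: (class_C_comp (h := GRing.inv) oI smooth_inv) => [x /pos/=|].
  by rewrite -sqrtr_gt0; exact: lt0r_neq0.
apply: (class_C_comp (h := Num.sqrt) oI smooth_sqrt) => [//|].
apply: class_CD => //; first exact: class_C_cst.
by apply: class_CN => //; apply: class_CM => //; exact: class_C_id.
Qed.

End Elementary.

(** * Closure properties of smooth maps *)

Section Closure.
Context {R : realType}.

Section Domain.
Variables (V : normedModType R) (U : set V).
Hypothesis oU : open U.

Lemma smooth_cst (W : normedModType R) (c : W) : smooth_on U (fun=> c).
Proof. by move=> k; exact: class_C_cst. Qed.

Lemma smooth_id : smooth_on U (fun x => x).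
Proof. by move=> k; exact: class_C_id. Qed.

Lemma smoothD (W : normedModType R) (f g : V -> W) :
  smooth_on U f -> smooth_on U g -> smooth_on U (fun x => f x + g x).
Proof. by move=> sf sg k; exact: class_CD. Qed.

Lemma smoothM (f g : V -> R) :
  smooth_on U f -> smooth_on U g -> smooth_on U (fun x => f x * g x).
Proof. by move=> sf sg k; exact: class_CM. Qed.

Lemma smoothN (f : V -> R) : smooth_on U f -> smooth_on U (fun x => - f x).
Proof. by move=> sf k; exact: class_CN. Qed.

Lemma smoothX (f : V -> R) n : smooth_on U f -> smooth_on U (fun x => f x ^+ n).
Proof.
move=> sf; elim: n => [|n IH]; first exact: smooth_cst.
have -> : (fun x => f x ^+ n.+1) = fun x => f x * f x ^+ n.
  by apply/funext => x; rewrite exprS.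
exact: smoothM.
Qed.

Lemma smooth_pair (W1 W2 : normedModType R) (f : V -> W1) (g : V -> W2) :
  smooth_on U f -> smooth_on U g -> smooth_on U (fun x => (f x, g x)).
Proof. by move=> sf sg k; exact: class_C_pair. Qed.

Lemma smooth_fst (W1 W2 : normedModType R) (f : V -> W1 * W2) :
  smooth_on U f -> smooth_on U (fun x => (f x).1).
Proof.
move=> sf k; apply: (class_C_linear (l := fst)) => //.
by move=> x; exact: cvg_fst.
Qed.

Lemma smooth_snd (W1 W2 : normedModType R) (f : V -> W1 * W2) :
  smooth_on U f -> smooth_on U (fun x => (f x).2).
Proof.
move=> sf k; apply: (class_C_linear (l := snd)) => //.
by move=> x; exact: cvg_snd.
Qed.

Lemma smooth_comp (B : set R) (h : R -> R) (f : V -> R) :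
  smooth_on B h -> (forall x, U x -> B (f x)) ->
  smooth_on U f -> smooth_on U (fun x => h (f x)).
Proof. by move=> sh fB sf k; apply: class_C_comp (sf k). Qed.

Lemma smooth_sin (f : V -> R) :
  smooth_on U f -> smooth_on U (fun x => sin (f x)).
Proof.
by apply: (smooth_comp (B := setT)) => // k; have [] := class_C_trigo (R := R) k.
Qed.

Lemma smooth_cos (f : V -> R) :
  smooth_on U f -> smooth_on U (fun x => cos (f x)).
Proof.
by apply: (smooth_comp (B := setT)) => // k; have [] := class_C_trigo (R := R) k.
Qed.

Lemma smoothV (f : V -> R) : (forall x, U x -> f x != 0) ->
  smooth_on U f -> smooth_on U (fun x => (f x)^-1).
Proof. exact: (smooth_comp smooth_inv). Qed.

End Domain.

Lemma smooth_continuous (V W : normedModType R) (f : V -> W) :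
  smooth_on setT f -> continuous f.
Proof. by move=> sf x; exact: (sf 0%N). Qed.

Lemma open_gt0 (V : normedModType R) (f : V -> R) :
  smooth_on setT f -> open [set x | 0 < f x].
Proof.
move=> sf; apply: (@open_comp _ _ f [set x | 0 < x]); last exact: open_gt.
by move=> x _; exact: smooth_continuous.
Qed.

Lemma openX (V W : normedModType R) (A : set V) (B : set W) :
  open A -> open B -> open (A `*` B).
Proof.
move=> oA oB; rewrite (_ : A `*` B = fst @^-1` A `&` snd @^-1` B) //.
apply: openI; apply: open_comp => // x _; [exact: cvg_fst|exact: cvg_snd].
Qed.

End Closure.

(** Reduces the smoothness of an expression to side conditions on the arguments of
    the inverse, the square root and the arcsine. *)
Ltac smooth := do ![assumption
  | exact: smooth_id | exact: smooth_cst
  | apply: smooth_pair | apply: smoothD | apply: smoothM | apply: smoothN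
  | apply: smoothX | apply: smooth_sin | apply: smooth_cos
  | apply: smooth_fst | apply: smooth_snd | apply: smoothV
  | apply: (smooth_comp _ smooth_atan) | apply: (smooth_comp _ smooth_asin)
  | apply: (smooth_comp _ smooth_sqrt)].

(** A two-sided inverse on some open set [B] containing the image suffices, even if
    it does not map [B] into [U]: the image is then [B `&` g @^-1` U], which is open
    by continuity of [g].  The image itself never has to be computed. *)
Lemma diffeo_onI (R : realType) (V W : normedModType R) (U : set V) (B : set W)
    (f : V -> W) (g : W -> V) :
  open U -> open B -> smooth_on U f -> smooth_on B g ->
  (forall x, U x -> B (f x)) ->
  (forall x, U x -> g (f x) = x) -> (forall y, B y -> f (g y) = y) ->
  diffeo_on U f.
Proof.
move=> oU oB sf sg fB gf fg.
have fU : f @` U = B `&` g @^-1` U.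
  apply/seteqP; split=> [_ [x Ux <-]|y [By Uy]] /=.
    by split; [exact: fB|rewrite gf].
  by exists (g y) => //; exact: fg.
have ofU : open (f @` U).
  rewrite fU openE => y [By gy].
  have nB : nbhs y B by exact: open_nbhs_nbhs.
  have ngU : nbhs y (g @^-1` U).
    by apply: (sg 0%N) => //; exact: open_nbhs_nbhs.
  exact: filterI.
split=> //; exists g => // k.
suff cS (W' : normedModType R) (h : W -> W') :
  class_C k B h -> class_C k (f @` U) h by exact: cS.
rewrite fU; elim: k h => [|k IH] h; first by move=> ch y [/ch].
by move=> [dh ch]; split=> [y [/dh]//|v]; exact: IH (ch v).
Qed.

(** * Trigonometric identities and polar coordinates *)

Section Trigonometry.
Context {R : realType}.

Lemma polar_coordinates (v w : R) : (v, w) != (0, 0) ->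
  exists2 m, 0 < m & exists theta, v = m * cos theta /\ w = m * sin theta.
Proof.
move=> vw0; have n0 : 0 < v ^+ 2 + w ^+ 2.
  rewrite lt_neqAle eq_sym paddr_eq0 ?sqr_ge0// !sqrf_eq0 -xpair_eqE vw0.
  by rewrite addr_ge0 ?sqr_ge0.
set m := Num.sqrt (v ^+ 2 + w ^+ 2).
have m0 : 0 < m by rewrite sqrtr_gt0.
have m2 : m ^+ 2 = v ^+ 2 + w ^+ 2 by rewrite sqr_sqrtr// ltW.
have vm : -1 <= v / m <= 1.
  rewrite -ler_norml normrM normfV (gtr0_norm m0) ler_pdivrMr// mul1r.
  rewrite -(ler_pXn2r (ltn0Sn 1)) ?nnegrE ?(ltW m0)// real_normK ?num_real//.
  by rewrite m2 lerDl sqr_ge0.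
have cosE : m * cos (acos (v / m)) = v.
  by rewrite acosK ?in_itv//= mulrC divfK// gt_eqF.
have sinE : m * sin (acos (v / m)) = `|w|.
  rewrite sin_acos//; have -> : 1 - (v / m) ^+ 2 = (w / m) ^+ 2.
    rewrite !expr_div_n m2; field.
    by rewrite gt_eqF.
  by rewrite sqrtr_sqr normrM normfV (gtr0_norm m0) mulrC divfK// gt_eqF.
exists m => //; have [w0|w0] := leP 0 w.
  by exists (acos (v / m)); rewrite cosE sinE ger0_norm.
by exists (- acos (v / m)); rewrite cosN sinN mulrN cosE sinE ltr0_norm// opprK.
Qed.

Lemma cos_atan_gt0 (y : R) : 0 < cos (atan y).
Proof. by apply: cos_gt0_pihalf; rewrite atan_gtNpi2 atan_ltpi2. Qed.

Lemma cos_atan_sqr (y : R) : cos (atan y) ^+ 2 * (1 + y ^+ 2) = 1.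
Proof.
rewrite -[y in X in _ * X]atanK -cos2_tan2 ?gt_eqF ?cos_atan_gt0//.
by rewrite mulfV// expf_neq0// gt_eqF// cos_atan_gt0.
Qed.

Lemma sin_atan (y : R) : sin (atan y) = y * cos (atan y).
Proof. by rewrite -[y in y * _]atanK /tan divfK// gt_eqF// cos_atan_gt0. Qed.

Lemma cos_double (y : R) : cos (2 * y) = 2 * cos y ^+ 2 - 1.
Proof. by rewrite !mulr_natl cos_mulr2n. Qed.

Lemma sin_double (y : R) : sin (2 * y) = 2 * (sin y * cos y).
Proof. by rewrite !mulr_natl sin_mulr2n mulrC. Qed.

End Trigonometry.

(** * The equivalence between the wave and the model bifurcation *)

Section Equivalence.
Context {R : realType}.

Definition spatial_wave (p : R * R) : R * R := (cos p.2 - cos p.1, sin p.2).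

Definition wave (q : R * R * R) : R * R :=
  ((cos q.1.2 - cos q.1.1) * cos q.2 + cos q.1.2 * sin q.2,
   sin q.1.2 * cos q.2).

(** The solution T = 2 t / (1 - t) of the matching equations, with T = tan s. *)
Definition wave_time (t : R) : R := atan (2 * t / (1 - t)).

(** [cos (atan y)] stands for [1 / sqrt (1 + y ^+ 2)]: in this form the inverse map
    only needs [tan] and [cos] of the same half-angle. *)
Definition wave_source (t : R) (p : R * R) : R * R :=
  (2 * asin (p.1 * cos (atan p.2) / Num.sqrt (1 - t)), 2 * atan p.2).

(** The factor [2 / (1 + w ^+ 2)] is [sin Y / w] for [w = tan (Y / 2)]. *)
Definition wave_target (t : R) (z : R * R) : R * R :=
  let rho := 2 * cos (wave_time t) / (1 + z.2 ^+ 2) in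
  (rho * (z.1 / (1 - t)), rho * z.2).

Definition times : set R := [set t | - (1 / 2) < t < 1 / 2].

(** Contained in the domain of [wave_source t] for all [t] in [times], where
    [1 / 2 < 1 - t], so that one neighbourhood serves the whole family. *)
Definition source_dom : set (R * R) :=
  [set p | 0 < 1 + p.2 ^+ 2 - 2 * p.1 ^+ 2].

(** The map [w |-> 2 w / (1 + w ^+ 2)] is injective only up to [`|w| = 1]. *)
Definition target_dom : set (R * R) := [set z | 0 < 1 - z.2 ^+ 2].

Lemma times_sub_gt0 t : times t -> 0 < 1 - t.
Proof. by move=> /andP[_ t1]; lra. Qed.

Lemma one_sqr_gt0 (w : R) : 0 < 1 + w ^+ 2.
Proof. by rewrite ltr_pwDl// sqr_ge0. Qed.

Lemma source_asin_arg t p : times t -> source_dom p ->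
  -1 < p.1 * cos (atan p.2) / Num.sqrt (1 - t) < 1.
Proof.
move=> tJ pU; rewrite -ltr_norml -(expr_lt1 (ltn0Sn 1))//
  real_normK ?num_real//.
have t0 := times_sub_gt0 tJ.
rewrite expr_div_n sqr_sqrtr ?ltW// ltr_pdivrMr// mul1r.
have c2 := cos_atan_sqr p.2; have y0 := one_sqr_gt0 p.2.
rewrite -(ltr_pM2r y0) exprMn -mulrA c2 mulr1.
case/andP: tJ => _ t1; move: pU; rewrite /source_dom /= => pU.
have : (1 / 2) * (1 + p.2 ^+ 2) < (1 - t) * (1 + p.2 ^+ 2).
  by rewrite ltr_pM2r//; lra.
lra.
Qed.

(** By the choice of the time change and of the radial factor, [1 - cos X] must equal
    [2 * (x ^+ 2 / (1 + y ^+ 2) / (1 - t))], which is what the arcsine in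
    [wave_source] provides through [cos (2 A) = 1 - 2 sin^2 A]. *)
Lemma wave_conjugacy t p : times t -> source_dom p ->
  wave (wave_source t p, wave_time t) =
  wave_target t (p.1 ^+ 2 - p.2 ^+ 2 + t, p.2).
Proof.
move=> tJ pU; have t0 := times_sub_gt0 tJ; have := source_asin_arg tJ pU.
case: p pU => x y /= _ xB; rewrite /wave /wave_source /wave_target /=.
have c2 := cos_atan_sqr y; have y0 := one_sqr_gt0 y.
have cE : cos (atan y) ^+ 2 = (1 + y ^+ 2)^-1.
  by apply: (mulIf (lt0r_neq0 y0)); rewrite mulVf ?gt_eqF.
have cX : cos (2 * asin (x * cos (atan y) / Num.sqrt (1 - t))) =
    1 - 2 * (x ^+ 2 / (1 + y ^+ 2) / (1 - t)).
  have xB' : x * cos (atan y) / Num.sqrt (1 - t) \in `[-1, 1].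
    by rewrite in_itv/=; case/andP: xB => /ltW -> /ltW ->.
  rewrite cos_double cos2sin2 asinK// expr_div_n sqr_sqrtr ?ltW// exprMn cE; lra.
have sY : sin (2 * atan y) = 2 * (y / (1 + y ^+ 2)).
  by rewrite sin_double sin_atan -mulrA -expr2 cE.
rewrite cX cos_double cE sY.
rewrite [sin (wave_time t)]sin_atan -/(wave_time t).
by congr (_, _); field; rewrite ?gt_eqF.
Qed.

Lemma wave_time0 : wave_time 0 = 0.
Proof. by rewrite /wave_time mulr0 mul0r atan0. Qed.

Lemma open_times : open times.
Proof. by rewrite /times -set_itvoo; exact: interval_open. Qed.

Lemma open_source_dom : open source_dom.
Proof. by have oT := @openT (R * R)%type; apply: open_gt0; smooth. Qed.

Lemma open_target_dom : open target_dom.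
Proof. by have oT := @openT (R * R)%type; apply: open_gt0; smooth. Qed.

(** Parameter and point both depend on [v], which covers a single member of a family
    (constant [t]) as well as joint smoothness ([t] and [p] the two projections). *)
Section Parametrized.
Variables (V : normedModType R) (U : set V) (t : V -> R) (p : V -> R * R).
Hypotheses (oU : open U) (st : smooth_on U t) (sp : smooth_on U p).
Hypothesis tJ : forall v, U v -> times (t v).

Let t0 v : U v -> 0 < 1 - t v.
Proof. by move=> /tJ/times_sub_gt0. Qed.

Let tn0 v : U v -> 1 - t v != 0.
Proof. by move=> /t0/lt0r_neq0. Qed.

Lemma smooth_wave_time : smooth_on U (fun v => wave_time (t v)).
Proof. by rewrite /wave_time; smooth. Qed.

Lemma smooth_wave_source : (forall v, U v -> source_dom (p v)) ->
  smooth_on U (fun v => wave_source (t v) (p v)).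
Proof.
move=> pU; rewrite /wave_source; smooth => // v Uv /=.
- exact: source_asin_arg (tJ Uv) (pU _ Uv).
- by rewrite gt_eqF// sqrtr_gt0; exact: t0.
Qed.

Lemma smooth_wave_target : smooth_on U (fun v => wave_target (t v) (p v)).
Proof.
have sT := smooth_wave_time.
by rewrite /wave_target; smooth => // v _; rewrite gt_eqF// one_sqr_gt0.
Qed.

End Parametrized.

(** Solving [T = 2 t / (1 - t)] gives [t = T / (2 + T)] with [T = tan s]; the condition
    [0 < 2 * cos s + sin s] says that [2 + T] is positive. *)
Lemma diffeo_wave_time : local_diffeo wave_time 0 0.
Proof.
split; first exact: wave_time0.
exists times; first by split; [exact: open_times|rewrite /times/=; lra].
pose B := [set s : R | - (pi / 2) < s < pi / 2] `&`
  [set s | 0 < 2 * cos s + sin s].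
have oR := @openT R.
have oB : open B.
  apply: openI; first by rewrite -set_itvoo; exact: interval_open.
  by apply: open_gt0; smooth.
apply: (diffeo_onI (B := B) (g := fun s => sin s / (2 * cos s + sin s))) => //.
- exact: open_times.
- have oJ := open_times.
  by apply: (smooth_wave_time (t := id)) => //; exact: smooth_id.
- by smooth => // s [_ /lt0r_neq0].
- move=> t tJ; have t0 := times_sub_gt0 tJ; split => /=.
    by rewrite atan_gtNpi2 atan_ltpi2.
  rewrite sin_atan -/(wave_time t) -mulrDl pmulr_lgt0 ?cos_atan_gt0//.
  by rewrite (_ : _ + _ = 2 / (1 - t)) ?divr_gt0//; field; rewrite gt_eqF.
- move=> t tJ; have t0 := times_sub_gt0 tJ.
  rewrite sin_atan -/(wave_time t); have c0 := cos_atan_gt0 (2 * t / (1 - t)).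
  field; rewrite gt_eqF//=; apply: lt0r_neq0.
  rewrite (_ : _ + _ = 2 * cos (wave_time t)); last by ring.
  by rewrite mulr_gt0.
- move=> s [sB /= s0]; rewrite /wave_time.
  have c0 := cos_gt0_pihalf sB.
  rewrite -[RHS](tanK (x := s)) ?in_itv//; congr atan; rewrite /tan; field.
  by rewrite addrK !lt0r_neq0// mulr_gt0.
Qed.

(** [y = tan (Y / 2)] and [x = sqrt (1 - t) sin (X / 2) / cos (Y / 2)] on the square
    [`|X|, `|Y| < pi]. *)
Lemma diffeo_wave_source t : times t -> diffeo_on source_dom (wave_source t).
Proof.
move=> tJ; have t0 := times_sub_gt0 tJ.
have st : 0 < Num.sqrt (1 - t) by rewrite sqrtr_gt0.
pose I := [set X : R | - pi < X < pi].
have oI : open I by rewrite /I -set_itvoo; exact: interval_open.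
have oII := openX oI oI.
have half (X : R) : I X -> - (pi / 2) < 1 / 2 * X < pi / 2.
  by move=> /andP[X1 X2]; lra.
have cos0 (P : R * R) : (I `*` I) P -> cos (1 / 2 * P.2) != 0.
  by move=> [_ /half/cos_gt0_pihalf/lt0r_neq0].
apply: (diffeo_onI (B := I `*` I) (g := fun P =>
  (Num.sqrt (1 - t) * sin (1 / 2 * P.1) / cos (1 / 2 * P.2),
   sin (1 / 2 * P.2) / cos (1 / 2 * P.2)))) => //.
- exact: open_source_dom.
- have oS := open_source_dom.
  by apply: (smooth_wave_source (t := fun=> t) (p := id)) => //; smooth.
- by smooth.
- move=> p pU; have /andP[z1 z2] := source_asin_arg tJ pU.
  split => /=; rewrite /I /=.
    set z := p.1 * _ / _ in z1 z2 *.
    have a1 : - (pi / 2) < asin z by rewrite asin_gtNpi2// z1 ltW.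
    have a2 : asin z < pi / 2 by rewrite asin_ltpi2// z2 ltW.
    lra.
  by have := atan_gtNpi2 p.2; have := atan_ltpi2 p.2; lra.
- move=> p pU; have /andP[z1 z2] := source_asin_arg tJ pU.
  have c0 := cos_atan_gt0 p.2; rewrite /wave_source /=.
  have halfK (X : R) : 1 / 2 * (2 * X) = X by field.
  rewrite !halfK asinK ?in_itv/= ?(ltW z1) ?(ltW z2)// sin_atan.
  by rewrite [RHS]surjective_pairing; congr (_, _); field; rewrite ?gt_eqF.
- move=> [X Y] [/= /half X2 /half Y2]; have c0 := cos_gt0_pihalf Y2.
  rewrite /wave_source /= -/(tan _) tanK ?in_itv//.
  rewrite (_ : Num.sqrt (1 - t) * _ / _ * _ / _ = sin (1 / 2 * X)); last first.
    by field; rewrite ?gt_eqF.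
  rewrite sinK ?in_itv/=; last by case/andP: X2 => /ltW -> /ltW ->.
  by congr (_, _); field.
Qed.

(** The root [w] of [2 w / (1 + w ^+ 2) = V] with [`|w| < 1], where [V = W / cos s], is
    [V / (1 + sqrt (1 - V ^+ 2))]; then [u] is obtained by a division. *)
Lemma diffeo_wave_target t : times t -> diffeo_on target_dom (wave_target t).
Proof.
move=> tJ; have t0 := times_sub_gt0 tJ; rewrite /wave_target.
have c0 : 0 < cos (wave_time t) by exact: cos_atan_gt0.
move: (cos _) c0 => c c0.
have oT := @openT (R * R)%type.
pose B := [set P : R * R | 0 < 1 - (P.2 / c) ^+ 2].
have oB : open B by apply: open_gt0; smooth => // P _; exact: lt0r_neq0.
pose w (P : R * R) := P.2 / c / (1 + Num.sqrt (1 - (P.2 / c) ^+ 2)).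
have den0 (P : R * R) : 0 < 1 + Num.sqrt (1 - (P.2 / c) ^+ 2).
  by rewrite ltr_pwDl// sqrtr_ge0.
have sw : smooth_on B w by rewrite /w; smooth => // P _; exact: lt0r_neq0.
have VE (z : R * R) : 1 - (2 * c / (1 + z.2 ^+ 2) * z.2 / c) ^+ 2 =
    ((1 - z.2 ^+ 2) / (1 + z.2 ^+ 2)) ^+ 2.
  by have z0 := one_sqr_gt0 z.2; field; rewrite !gt_eqF.
have oD := open_target_dom.
apply: (diffeo_onI (B := B) (g := fun P =>
  (P.1 * (1 + w P ^+ 2) / (2 * c) * (1 - t), w P))) => //.
- by smooth => // v _; rewrite gt_eqF// one_sqr_gt0.
- by smooth => // v _; rewrite gt_eqF// mulr_gt0.
- move=> z zD; rewrite /B /= VE exprn_gt0// divr_gt0//; exact: one_sqr_gt0.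
- move=> z zD; have z0 := one_sqr_gt0 z.2.
  have wz : w (2 * c / (1 + z.2 ^+ 2) * (z.1 / (1 - t)),
               2 * c / (1 + z.2 ^+ 2) * z.2) = z.2.
    rewrite /w /= VE sqrtr_sqr ger0_norm; last by rewrite divr_ge0// ltW.
    field; rewrite !gt_eqF//= (_ : _ + _ = 2)//; ring.
  rewrite wz [RHS]surjective_pairing /=; congr (_, _); field.
  by rewrite !gt_eqF.
- move=> P PB; have d0 := den0 P; set q := Num.sqrt _ in d0.
  have q2 : q ^+ 2 = 1 - (P.2 / c) ^+ 2 by rewrite sqr_sqrtr// ltW.
  have w2 : 1 + w P ^+ 2 = 2 / (1 + q).
    have -> : w P ^+ 2 = (1 - q ^+ 2) / (1 + q) ^+ 2.
      by rewrite /w -/q expr_div_n q2; congr (_ / _); ring.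
    by field; rewrite gt_eqF.
  rewrite /= w2 [RHS]surjective_pairing.
  by congr (_, _); last rewrite /w -/q; field; rewrite !gt_eqF.
Qed.

(** Only the direction of [(cos theta / (1 - t), sin theta)] matters, and its polar
    angle is the one of the image ray. *)
Lemma radial_wave_target t : times t -> radial_on target_dom (wave_target t).
Proof.
move=> tJ; split; first exact: diffeo_wave_target.
  by rewrite /wave_target/= mul0r !mulr0.
move=> theta; have t0 := times_sub_gt0 tJ.
have c0 : 0 < cos (wave_time t) by exact: cos_atan_gt0.
have [|m m0 [theta' [cE sE]]] := @polar_coordinates _ (cos theta / (1 - t)) (sin theta).
  rewrite xpair_eqE mulf_eq0 invr_eq0 (gt_eqF t0) orbF.
  apply/negP => /andP[/eqP c /eqP s]; have /eqP := cos2Dsin2 theta.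
  by rewrite c s expr0n addr0 eq_sym oner_eq0.
exists theta' => _ [_ [_ [r r0 ->]] <-]; rewrite /wave_target /=.
set rho := 2 * _ / _; exists (rho * (r * m)).
  by rewrite pmulr_rgt0 ?mulr_gt0// invr_gt0 one_sqr_gt0.
by rewrite sE -[r * _ / _]mulrA cE !mulrA.
Qed.

Lemma wave_source_origin t : wave_source t (0, 0) = ((0, 0) : R * R).
Proof.
have asin0 : asin 0 = 0 :> R.
  by rewrite -[X in asin X]sin0 sinK// in_itv/=; have := @pi_gt0 R; lra.
by rewrite /wave_source /= !mul0r atan0 asin0 mulr0.
Qed.

Lemma times0 : times 0.
Proof. by rewrite /times/=; lra. Qed.

Lemma source_dom0 : source_dom (0, 0).
Proof. by rewrite /source_dom/=; lra. Qed.

Lemma target_dom0 : target_dom (0, 0).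
Proof. by rewrite /target_dom/=; lra. Qed.

(** The member [t = 0] of the family of equivalences. *)
Lemma hyperbolic_spatial_wave : has_hyperbolic_singularity spatial_wave (0, 0).
Proof.
have [t0 U0] := (times0, source_dom0).
split; [by rewrite /spatial_wave/= subrr sin0|
  by rewrite /hyperbolic_germ/= expr0n subrr|].
exists (wave_source 0), (wave_target 0); split.
- split; first exact: wave_source_origin.
  exists source_dom; last exact: diffeo_wave_source.
  by split=> //; exact: open_source_dom.
- exists target_dom; last exact: radial_wave_target.
  by split; [exact: open_target_dom|exact: target_dom0].
- apply: filterS (open_nbhs_nbhs (conj open_source_dom U0)) => p pU.
  have := wave_conjugacy t0 pU.
  by rewrite wave_time0 /wave/= cos0 sin0 !mulr1 mulr0 !addr0.
Qed.

Lemma wave_realizes_bifurcation :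
  realizes_bifurcation wave hyperbolic_bifurcation.
Proof.
have [t0 U0] := (times0, source_dom0).
split; [by rewrite /wave/= subrr sin0 mul0r mulr0 addr0|
  by rewrite /= expr0n subrr addr0|].
exists wave_time, wave_source, wave_target; split.
- exact: diffeo_wave_time.
- split; last exact: wave_source_origin.
  exists source_dom, times; split; [by split=> //; exact: open_source_dom|
    by split=> //; exact: open_times| |exact: diffeo_wave_source].
  have oUJ := openX open_source_dom open_times.
  by apply: (smooth_wave_source (t := snd) (p := fst)) => // [||q []//|q []//]; smooth.
- exists target_dom, times; split;
    [|by split=> //; exact: open_times| |exact: radial_wave_target].
    by split; [exact: open_target_dom|exact: target_dom0].
  have oUJ := openX open_target_dom open_times.
  by apply: (smooth_wave_target (t := snd) (p := fst)) => // [||q []//]; smooth.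
- have oUJ := openX open_source_dom open_times.
  have nUJ : nbhs ((0, 0, 0) : R * R * R) (source_dom `*` times).
    exact: open_nbhs_nbhs.
  apply: filterS nUJ => -[[x y] t] [pU tJ] /=.
  exact: (wave_conjugacy tJ pU).
Qed.

End Equivalence.

(** * The Helmholtz and wave equations *)

Section Helmholtz.
Context {R : realType}.

Lemma is_derive1M (f g : R -> R) (x f' g' : R) :
  is_derive x 1 f f' -> is_derive x 1 g g' ->
  is_derive x 1 (fun s => f s * g s) (f' * g x + f x * g').
Proof.
move=> df dg; apply: (is_derive_eq (is_deriveM df dg)).
by rewrite addrC [_ *: _]mulrC.
Qed.

Lemma is_derive1D (f g : R -> R) (x f' g' : R) :
  is_derive x 1 f f' -> is_derive x 1 g g' ->
  is_derive x 1 (fun s => f s + g s) (f' + g').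
Proof. by move=> df dg; exact: is_deriveD. Qed.

Lemma is_derive1N (f : R -> R) (x f' : R) :
  is_derive x 1 f f' -> is_derive x 1 (fun s => - f s) (- f').
Proof. by move=> df; exact: is_deriveN. Qed.

Lemma is_derive1_cst (a x : R) : is_derive x 1 (fun=> a) 0.
Proof. exact: is_derive_cst. Qed.

Lemma derive1_pair (f g : R -> R) (x f1 g1 f' g' : R) :
  is_derive x 1 f f1 -> is_derive x 1 g g1 -> f1 = f' -> g1 = g' ->
  'D_1 (fun s => (f s, g s)) x = (f', g').
Proof.
move=> [df <-] [dg <-] <- <-.
have /derivable1_diffP dfx := df; have /derivable1_diffP dgx := dg.
have dfg : differentiable (fun s => (f s, g s)) x by exact: differentiable_pair.
by rewrite !deriveE// diff_pair.
Qed.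

(** Differentiates one-variable expressions in sin and cos by following their syntax.
    Unification is kept away from comparing sin with cos, whose unfoldings are power
    series. *)
Ltac derive1 := lazymatch goal with
  | |- is_derive _ _ (fun _ => ?a) _ =>
      notypeclasses refine (is_derive1_cst a _)
  | |- is_derive _ _ (fun s => sin s) _ => notypeclasses refine (is_derive_sin _)
  | |- is_derive _ _ sin _ => notypeclasses refine (is_derive_sin _)
  | |- is_derive _ _ (fun s => cos s) _ => notypeclasses refine (is_derive_cos _)
  | |- is_derive _ _ cos _ => notypeclasses refine (is_derive_cos _)
  | |- is_derive _ _ (fun s => @?f s + @?g s) _ =>
      notypeclasses refine (is_derive1D (f := f) (g := g) _ _); derive1
  | |- is_derive _ _ (fun s => @?f s * @?g s) _ =>
      notypeclasses refine (is_derive1M (f := f) (g := g) _ _); derive1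
  | |- is_derive _ _ (fun s => - @?f s) _ =>
      notypeclasses refine (is_derive1N (f := f) _); derive1
  end.

Ltac derive1_pair := notypeclasses refine (derive1_pair _ _ _ _);
  [derive1 | derive1 | cbn beta; ring | cbn beta; ring].

(** A directional derivative only depends on the restriction of the map to a line. *)
Lemma derive_line (V W : normedModType R) (f : V -> W) (c : R -> V) (v : V)
    (x : R) :
  (forall s, c s = (s - x) *: v + c x) ->
  'D_v f (c x) = 'D_1 (fun s => f (c s)) x.
Proof.
move=> cE; rewrite /derive /=.
under [in RHS]eq_fun do rewrite [_ *: 1]mulr1 cE addrK.
by [].
Qed.

Lemma derive_twice (V W : normedModType R) (f g h : V -> W) (v : V) :
  (forall p, 'D_v f p = g p) -> (forall p, 'D_v g p = h p) ->
  forall p, 'D_v ('D_v f) p = h p.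
Proof. by move=> fg gh p; have -> : 'D_v f = g by exact/funext. Qed.

Ltac derive_along c := apply: (derive_line _ (c := c)) => s;
  do ![apply/pair_equal_spec; split];
  by rewrite /= ?[_ *: 1]mulr1 ?scaler0 ?subrK ?add0r.

Section Plane.
Variables (f : R * R -> R * R) (x y : R).

Lemma derive_plane_x : 'D_(1, 0) f (x, y) = 'D_1 (fun s => f (s, y)) x.
Proof. derive_along (fun s : R => (s, y)). Qed.

Lemma derive_plane_y : 'D_(0, 1) f (x, y) = 'D_1 (fun s => f (x, s)) y.
Proof. derive_along (fun s : R => (x, s)). Qed.

End Plane.

Section SpaceTime.
Variables (f : R * R * R -> R * R) (x y t : R).

Lemma derive_space_x :
  'D_(1, 0, 0) f (x, y, t) = 'D_1 (fun s => f (s, y, t)) x.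
Proof. derive_along (fun s : R => (s, y, t)). Qed.

Lemma derive_space_y :
  'D_(0, 1, 0) f (x, y, t) = 'D_1 (fun s => f (x, s, t)) y.
Proof. derive_along (fun s : R => (x, s, t)). Qed.

Lemma derive_time :
  'D_(0, 0, 1) f (x, y, t) = 'D_1 (fun s => f (x, y, s)) t.
Proof. derive_along (fun s : R => (x, y, s)). Qed.

End SpaceTime.

Lemma spatial_wave_xx (p : R * R) :
  'D_(1, 0) ('D_(1, 0) (@spatial_wave R)) p = (cos p.1, 0).
Proof.
apply: (derive_twice (g := fun p : R * R => (sin p.1, 0))
  (h := fun p : R * R => (cos p.1, 0)))
  => -[x y]; rewrite derive_plane_x /spatial_wave /=; derive1_pair.
Qed.

Lemma spatial_wave_yy (p : R * R) :
  'D_(0, 1) ('D_(0, 1) (@spatial_wave R)) p = (- cos p.2, - sin p.2).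
Proof.
apply: (derive_twice (g := fun p : R * R => (- sin p.2, cos p.2))
  (h := fun p : R * R => (- cos p.2, - sin p.2)))
  => -[x y]; rewrite derive_plane_y /spatial_wave /=; derive1_pair.
Qed.

Lemma wave_xx (q : R * R * R) :
  'D_(1, 0, 0) ('D_(1, 0, 0) (@wave R)) q = (cos q.1.1 * cos q.2, 0).
Proof.
apply: (derive_twice (g := fun q : R * R * R => (sin q.1.1 * cos q.2, 0))
  (h := fun q : R * R * R => (cos q.1.1 * cos q.2, 0)))
  => -[[x y] t]; rewrite derive_space_x /wave /=; derive1_pair.
Qed.

Lemma wave_yy (q : R * R * R) :
  'D_(0, 1, 0) ('D_(0, 1, 0) (@wave R)) q =
  (- cos q.1.2 * cos q.2 - cos q.1.2 * sin q.2, - sin q.1.2 * cos q.2).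
Proof.
apply: (derive_twice (g := fun q : R * R * R =>
    (- sin q.1.2 * cos q.2 - sin q.1.2 * sin q.2, cos q.1.2 * cos q.2))
  (h := fun q : R * R * R =>
    (- cos q.1.2 * cos q.2 - cos q.1.2 * sin q.2, - sin q.1.2 * cos q.2)))
  => -[[x y] t]; rewrite derive_space_y /wave /=; derive1_pair.
Qed.

Lemma wave_tt (q : R * R * R) :
  'D_(0, 0, 1) ('D_(0, 0, 1) (@wave R)) q = - wave q.
Proof.
apply: (derive_twice (g := fun q : R * R * R =>
    (- (cos q.1.2 - cos q.1.1) * sin q.2 + cos q.1.2 * cos q.2,
     - sin q.1.2 * sin q.2))
  (h := fun q : R * R * R =>
    (- ((cos q.1.2 - cos q.1.1) * cos q.2 + cos q.1.2 * sin q.2),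
     - (sin q.1.2 * cos q.2))))
  => -[[x y] t]; rewrite derive_time /wave /=; derive1_pair.
Qed.

Lemma helmholtz_spatial_wave : helmholtz_solution 1 (@spatial_wave R).
Proof.
have oT := @openT (R * R)%type.
split; first by rewrite /spatial_wave; smooth.
move=> p; apply: etrans (congr2 (fun a b => a + b + _)
  (spatial_wave_xx p) (spatial_wave_yy p)) _.
by rewrite expr1n scale1r; apply/pair_equal_spec; split => /=; ring.
Qed.

Lemma helmholtz_wave_wave : helmholtz_wave 1 1 (@wave R).
Proof.
have oT := @openT (R * R * R)%type.
split; [exact: ltr01|exact: ltr01|by rewrite /wave; smooth|move=> q|move=> q].
  apply: etrans (congr2 (fun a b => a + b + _) (wave_xx q) (wave_yy q)) _.
  by rewrite expr1n scale1r; apply/pair_equal_spec; split => /=; ring.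
apply: etrans (wave_tt q) _; rewrite expr1n scale1r.
apply: etrans (esym (congr2 +%R (wave_xx q) (wave_yy q))).
by apply/pair_equal_spec; split => /=; ring.
Qed.

End Helmholtz.

Theorem proposition3p1 (R : realType) :
  let psi : R * R -> R * R := fun p =>
    (cos p.2 - cos p.1, sin p.2) in
  let Psi : R * R * R -> R * R := fun q =>
    let: (x, y, t) := q in
    ((cos y - cos x) * cos t + cos y * sin t, sin y * cos t) in
  [/\ helmholtz_solution 1 psi,
      has_hyperbolic_singularity psi (0, 0),
      helmholtz_wave 1 1 Psi,
      has_hyperbolic_singularity (fun p => Psi (p, 0)) (0, 0) &
      realizes_bifurcation Psi hyperbolic_bifurcation].
Proof.
move=> psi Psi.
have PsiE : Psi = wave by apply/funext => -[[x y] t].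
have Psi0 : (fun p => Psi (p, 0)) = psi.
  apply/funext => p; rewrite PsiE /wave/= cos0 sin0 !mulr1 mulr0 addr0.
  by [].
rewrite Psi0 PsiE; split.
- exact: helmholtz_spatial_wave.
- exact: hyperbolic_spatial_wave.
- exact: helmholtz_wave_wave.
- exact: hyperbolic_spatial_wave.
- exact: wave_realizes_bifurcation.
Qed.
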